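(* Let $G$ be a countable infinite discrete group and $\alpha: G\curvearrowright X$ a continuous action on the Cantor set $X$ such that there is no $G$-invariant non-trivial Borel measure on $X$. Then the type semigroup $W(X,G)$ is almost unperforated if and only if $\alpha$ has paradoxical comparison.
   Context: A Borel measure $\mu$ on $X$ (possibly unbounded) is non-trivial if there is a clopen $O\subset X$ with $0<\mu(O)<\infty$. Subequivalence: for closed $F\subset X$ and open $O\subset X$, write $F\prec O$ if there exist a finite collection $\mathcal{U}$ of open sets covering $F$ and elements $s_U\in G$ such that the sets $s_UU$, $U\in\mathcal{U}$, are pairwise disjoint subsets of $O$. Paradoxical comparison: for every nonempty open $O\subset X$ and every closed $F\subset O$ there are disjoint nonempty open $O_1,O_2\subset O$ with $F\prec O_1$ and $F\prec O_2$. Type semigroup: on $C(X,\mathbb{Z}_{\ge0})$ let $f\sim g$ if there are $h_1,\dots,h_n\in C(X,\mathbb{Z}_{\ge0})$ and $s_1,\dots,s_n\in G$ with $\sum_i h_i=f$ and $\sum_i h_i(s_i^{-1}\cdot)=g$; $W(X,G)=C(X,\mathbb{Z}_{\ge0})/\!\sim$ with $[f]+[g]=[f+g]$ and the algebraic preorder ($a\le b$ iff $a+c=b$ for some $c$). $W(X,G)$ is almost unperforated if whenever $x,y\in W(X,G)$, $n\in\mathbb{N}$ and $(n+1)x\le ny$, one has $x\le y$. *)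

(* Defs.v *)
From HB Require Import structures.
From mathcomp Require Import all_boot all_order all_algebra.
From mathcomp Require Import all_classical all_reals all_analysis.
From Stdlib Require Import Relations.
Set Implicit Arguments.
Unset Strict Implicit.
Unset Printing Implicit Defensive.
Import Order.TTheory GRing.Theory Num.Theory.
Local Open Scope classical_set_scope.

Notation X := cantor_space.

Definition BorelX := g_sigma_algebraType (@open X).

Definition is_group {G : Type} (mul : G -> G -> G) (inv : G -> G) (one : G) :=
  [/\ (forall a b c, mul a (mul b c) = mul (mul a b) c),
      (forall a, mul one a = a),
      (forall a, mul a one = a),
      (forall a, mul (inv a) a = one) &
      (forall a, mul a (inv a) = one)].

Definition is_action {G : Type} (mul : G -> G -> G) (one : G)
    (act : G -> X -> X) :=
  [/\ (forall x, act one x = x),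
      (forall g h x, act (mul g h) x = act g (act h x)) &
      (forall g, continuous (act g))].

Definition nontrivial_measure {R : realType} (mu : set BorelX -> \bar R) :=
  exists O : set X, clopen O /\ (0 < mu O)%E /\ (mu O < +oo)%E.

Definition invariant_measure {R : realType} {G : Type} (act : G -> X -> X)
    (mu : set BorelX -> \bar R) :=
  forall (g : G) (A : set BorelX), measurable A -> mu (act g @^-1` A) = mu A.

Definition subequiv {G : Type} (act : G -> X -> X) (F O : set X) :=
  exists (n : nat) (U : 'I_n -> set X) (s : 'I_n -> G),
    [/\ (forall i, open (U i)),
        F `<=` \bigcup_i U i,
        (forall i, act (s i) @` U i `<=` O) &
        (forall i j, i != j -> act (s i) @` U i `&` act (s j) @` U j = set0)].

Definition paradoxical_comparison {G : Type} (act : G -> X -> X) :=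
  forall O F : set X, open O -> O !=set0 -> closed F -> F `<=` O ->
    exists O1 O2 : set X,
      [/\ open O1 /\ open O2, O1 !=set0 /\ O2 !=set0,
          O1 `<=` O /\ O2 `<=` O, O1 `&` O2 = set0 &
          subequiv act F O1 /\ subequiv act F O2].

(* C(X, Z_{>=0}): continuity into the discrete space of natural numbers *)
Definition cont_nat (f : X -> nat) := forall k : nat, open (f @^-1` [set k]).

Definition type_rel {G : Type} (inv : G -> G) (act : G -> X -> X)
    (f g : X -> nat) :=
  exists (n : nat) (h : 'I_n -> X -> nat) (s : 'I_n -> G),
    [/\ (forall i, cont_nat (h i)),
        (forall x, f x = \sum_(i < n) h i x) &
        (forall x, g x = \sum_(i < n) h i (act (inv (s i)) x))].

(* equality in W(X,G) = C(X,Z_{>=0}) / ~ (equivalence generated by ~) *)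
Definition W_equiv {G : Type} (inv : G -> G) (act : G -> X -> X) :=
  clos_refl_sym_trans (X -> nat) (type_rel inv act).

Definition W_le {G : Type} (inv : G -> G) (act : G -> X -> X) (f g : X -> nat) :=
  exists c : X -> nat, cont_nat c /\ W_equiv inv act (fun x => f x + c x) g.

(* almost unperforation; (n+1)[f] = [(n+1) f] and n[g] = [n g] *)
Definition almost_unperforated {G : Type} (inv : G -> G) (act : G -> X -> X) :=
  forall (f g : X -> nat) (n : nat), cont_nat f -> cont_nat g -> (0 < n)%N ->
    W_le inv act (fun x => n.+1 * f x) (fun x => n * g x) ->
    W_le inv act f g.

(* Main.v *)
Require Import Defs.
From HB Require Import structures.
From mathcomp Require Import all_boot all_order all_algebra.
From mathcomp Require Import all_classical all_reals all_analysis.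
From mathcomp Require Import zify ring.
From Stdlib Require Import Relations.
Set Implicit Arguments.
Unset Strict Implicit.
Unset Printing Implicit Defensive.
Import Order.TTheory GRing.Theory Num.Theory.
Local Open Scope classical_set_scope.

(** Paradoxical comparison of a clopen set A with itself gives 2[1_A] <= [1_A];
    every element of W(X,G) is a finite sum of such classes, so 2x <= x holds
    throughout W(X,G), and (n+1)x <= ny yields x <= (n+1)x <= ny <= y.

    Conversely, if (n+1)[1_A] <= n[1_A] for no n, then Tarski's theorem gives an
    additive monotone nu : W(X,G) -> [0,oo] with nu [1_A] = 1. By compactness the
    induced function on clopen sets is countably additive, and its Caratheodory
    extension is an invariant nontrivial Borel measure. Without such measures,
    (n+1)[1_A] <= n[1_A] for some n, hence (k+1) 2[1_A] <= k[1_A] for k = n+1, and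
    almost unperforation gives 2[1_A] <= [1_A]. Splitting this relation exhibits
    two disjoint open subsets of A, to each of which A is subequivalent; it
    remains to squeeze a clopen A between F and O.

    Tarski's theorem is obtained from a maximal compatible preorder on the monoid
    that still has no (n+1)u <= nu. Such a preorder is total on the elements
    dominated by multiples of u, and there nu x = inf {k/m | mx <= ku} is
    additive. *)

(** * Cylinders and clopen sets *)

Section CantorTopology.
Implicit Types (x y : X) (A F O : set X) (n : nat).

Definition cylinder n x : set X := [set y | forall i, (i < n)%N -> y i = x i].

Lemma cylinder_sym n x y : cylinder n x y -> cylinder n y x.
Proof. by move=> xy i /xy. Qed.

Lemma cylinder_trans n x y z : cylinder n x y -> cylinder n y z -> cylinder n x z.
Proof. by move=> xy yz i ni; rewrite yz// xy. Qed.

Lemma cylinder_le m n x : (m <= n)%N -> cylinder n x `<=` cylinder m x.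
Proof. by move=> mn y xy i im; apply: xy; exact: leq_trans mn. Qed.

Lemma clopen_coord i (b : bool) : clopen [set x : X | x i = b].
Proof.
have cts := @proj_continuous nat (fun=> bool) i.
have clb : clopen [set b] by split; [exact: discrete_open|exact: discrete_closed].
have -> : [set x : X | x i = b] =
    (proj i : prod_topology (fun=> bool) -> bool) @^-1` [set b] by [].
by apply: preimage_clopen => // x _; exact: cts.
Qed.

Lemma clopen_cylinder n x : clopen (cylinder n x).
Proof.
elim: n => [|n IH].
  have -> : cylinder 0 x = setT by rewrite -subTset.
  exact: clopenT.
have -> : cylinder n.+1 x = cylinder n x `&` [set y | y n = x n].
  apply/seteqP; split => [y xy|y [xy yn] i].
    by split => [i ni|]; apply: xy => //; exact: leqW.
  by rewrite ltnS leq_eqVlt => /orP[/eqP ->//|]; exact: xy.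
by apply: clopenI => //; exact: clopen_coord.
Qed.

(** The neighbourhood [U m] of a point works for every index from [m] on, which is what
    near-covering compactness asks for. Later compactness arguments take [U n] to be the points that
    are good at stage [n]. *)
Lemma compact_increasing_cover A (U : nat -> set X) :
  closed A -> (forall n, open (U n)) ->
  {homo U : m n / (m <= n)%N >-> m `<=` n} ->
  A `<=` \bigcup_n U n -> exists n, A `<=` U n.
Proof.
move=> clA oU Ule AU.
have /compact_near_coveringP cA : compact A.
  exact: (subclosed_compact clA cantor_space_compact).
have [|N _ NP] := cA nat \oo (fun n x => U n x) _ _.
  move=> x /AU[m _ Umx]; exists (U m, [set k | (m <= k)%N]) => /=.
    by split; [exact: open_nbhs_nbhs|exact: nbhs_infty_ge].
  by move=> [y k] /= [Uy mk]; exact: Ule mk _ Uy.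
by exists N; apply: NP => /=.
Qed.

(** The complement of [O] is compact and misses [x], and the complements of the cylinders at [x]
    increase to everything but [x]. *)
Lemma open_cylinder_sub O x : open O -> O x -> exists n, cylinder n x `<=` O.
Proof.
move=> oO Ox.
have [||||n Hn] := @compact_increasing_cover (~` O) (fun n => ~` cylinder n x).
- exact: open_closedC.
- by move=> n; apply: closed_openC; case: (clopen_cylinder n x).
- by move=> m n mn; apply: subsetC; exact: cylinder_le.
- move=> y nOy; apply: contrapT => nU; apply: nOy.
  suff -> : y = x by [].
  apply: funext => i; apply: contrapT => yxi; apply: nU.
  (* Depth [n] constrains only the coordinates below [n], so a difference at [i] shows at depth
     [i.+1]. *)
  by exists i.+1 => //= /(_ i (ltnSn i)).
by exists n; apply: subsetC2 => //.
Qed.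

Definition finitely_determined n A := forall x y, cylinder n x y -> A x -> A y.

Lemma finitely_determined_clopen n A : finitely_determined n A -> clopen A.
Proof.
move=> detA; split.
  rewrite openE => x Ax.
  apply: (@filterS _ _ _ (cylinder n x)) => [y xy|]; first exact: detA xy Ax.
  by apply: open_nbhs_nbhs; split => //; case: (clopen_cylinder n x).
rewrite -[A]setCK; apply: open_closedC; rewrite openE => x nAx.
apply: (@filterS _ _ _ (cylinder n x)) => [y xy Ay|].
  by apply: nAx; exact: (detA y x (cylinder_sym xy) Ay).
by apply: open_nbhs_nbhs; split => //; case: (clopen_cylinder n x).
Qed.

(** Lebesgue number lemma: the points whose depth-[n] cylinder fits into some [U i] form an open set
    that grows with [n]. *)
Lemma cylinder_lebesgue (I : Type) F (U : I -> set X) :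
  closed F -> (forall i, open (U i)) -> F `<=` \bigcup_i U i ->
  exists n, forall x, F x -> exists i, cylinder n x `<=` U i.
Proof.
move=> clF oU FU.
have [||||n Hn] := @compact_increasing_cover F
    (fun n => [set x | exists i, cylinder n x `<=` U i]) => //.
- move=> n; apply: (proj1 (@finitely_determined_clopen n _ _)).
  move=> x y xy [i xUi]; exists i => z yz; apply: xUi.
  exact: cylinder_trans yz.
- move=> m n mn x [i xUi]; exists i; apply: subset_trans xUi.
  exact: cylinder_le.
- move=> x /FU[i _ Uix]; have [n xUi] := open_cylinder_sub (oU i) Uix.
  by exists n => //; exists i.
by exists n.
Qed.

(** A Lebesgue depth for the one-set cover [O] of [F] serves all points of [F] at once, so the union
    of their cylinders is finitely determined. *)
Lemma clopen_between F O : closed F -> open O -> F `<=` O ->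
  exists A, [/\ clopen A, F `<=` A & A `<=` O].
Proof.
move=> clF oO FO.
have [||n Hn] := @cylinder_lebesgue unit F (fun=> O) clF.
- by [].
- by move=> x Fx; exists tt => //; exact: FO.
exists [set y | exists2 x, F x & cylinder n x y]; split.
- apply: (@finitely_determined_clopen n) => x y xy [z Fz zx].
  by exists z => //; exact: cylinder_trans xy.
- by move=> x Fx; exists x.
- by move=> y [x Fx xy]; have [_] := Hn x Fx; exact.
Qed.

Lemma open_bigcup_clopen O : open O ->
  exists U : nat -> set X, (forall i, clopen (U i)) /\ O = \bigcup_i U i.
Proof.
move=> oO.
pose U i := [set y | cylinder i y `<=` O].
exists U; split => [i|].
  apply: (@finitely_determined_clopen i) => x y xy xO z yz.
  by apply: xO; exact: cylinder_trans yz.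
apply/seteqP; split => [x Ox|x [i _]]; last by apply.
by have [n ?] := open_cylinder_sub oO Ox; exists n.
Qed.

End CantorTopology.

(** * Equidecomposability and the order of the type semigroup *)

Section ContinuousFunctions.
Implicit Types (f g : X -> nat) (A : set X).

Lemma cont_nat_op2 (op : nat -> nat -> nat) f g :
  cont_nat f -> cont_nat g -> cont_nat (fun x => op (f x) (g x)).
Proof.
move=> cf cg k.
have -> : (fun x => op (f x) (g x)) @^-1` [set k] =
    \bigcup_(p in [set p : nat * nat | op p.1 p.2 = k])
      (f @^-1` [set p.1] `&` g @^-1` [set p.2]).
  apply/seteqP; split => [x /= fgk|x [p /= <- [/= -> ->]//]].
  by exists (f x, g x).
by apply: bigcup_open => p _; apply: openI.
Qed.

Lemma cont_nat_cst (m : nat) : cont_nat (fun=> m).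
Proof.
move=> k; have [<-|mk] := eqVneq m k.
  by rewrite (_ : _ @^-1` _ = setT); [exact: openT|apply/seteqP; split].
rewrite (_ : _ @^-1` _ = set0); first exact: open0.
by apply/seteqP; split => // x /= /eqP; rewrite (negbTE mk).
Qed.

Lemma cont_nat_comp f (phi : X -> X) :
  continuous phi -> cont_nat f -> cont_nat (f \o phi).
Proof. by move=> cphi cf k; apply: (@open_comp _ _ phi (f @^-1` [set k])). Qed.

Lemma cont_nat_preimage f (P : set nat) : cont_nat f -> clopen (f @^-1` P).
Proof.
move=> cf.
have oP Q : open (f @^-1` Q).
  have -> : f @^-1` Q = \bigcup_(k in Q) f @^-1` [set k].
    by apply/seteqP; split => [x ?|x [k Qk /= ->]//]; exists (f x).
  by apply: bigcup_open => k _.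
by split; [exact: oP|rewrite -[_ @^-1` P]setCK; apply: open_closedC; exact: (oP (~` P))].
Qed.

Lemma cont_nat_bounded f : cont_nat f -> exists N, forall x, (f x <= N)%N.
Proof.
move=> cf.
have [|||N fN] := @compact_increasing_cover setT
    (fun N => f @^-1` [set k | (k <= N)%N]) closedT.
- by move=> n; have [] := cont_nat_preimage [set k | (k <= n)%N] cf.
- by move=> m n mn x /= fm; exact: leq_trans mn.
- by move=> x _; exists (f x) => /=.
by exists N => x; exact: fN.
Qed.

Definition chi A : X -> nat := fun x => x \in A.

Lemma chi_gt0 A x : (0 < chi A x)%N <-> A x.
Proof.
rewrite /chi; split => [|Ax]; last by rewrite mem_set.
by have [/set_mem|] := boolP (x \in A).
Qed.

Lemma chi1 A x : A x -> chi A x = 1%N.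
Proof. by move=> Ax; rewrite /chi mem_set. Qed.

Lemma chi0 A x : ~ A x -> chi A x = 0%N.
Proof. by move=> Ax; rewrite /chi memNset. Qed.

Lemma cont_nat_chi A : clopen A -> cont_nat (chi A).
Proof.
move=> [oA cA] k.
have eqk B : (forall x, chi A x = k <-> B x) -> chi A @^-1` [set k] = B.
  by move=> kB; apply/seteqP; split => x /kB.
case: k eqk => [|[|k]] eqk.
- rewrite (eqk (~` A)); first exact: closed_openC.
  move=> x; have [Ax|nAx] := pselect (A x); first by rewrite chi1.
  by rewrite chi0.
- rewrite (eqk A) // => x; have [Ax|nAx] := pselect (A x); first by rewrite chi1.
  by rewrite chi0.
- rewrite (eqk set0); first exact: open0.
  by move=> x; rewrite /chi; case: (x \in A).
Qed.

Lemma chiU A B : A `&` B = set0 -> chi (A `|` B) = fun x => (chi A x + chi B x)%N.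
Proof.
move=> AB; apply: funext => x.
have [Ax|nAx] := pselect (A x).
  have nBx : ~ B x by move=> Bx; have : (A `&` B) x by []; rewrite AB.
  by rewrite (chi1 Ax) (chi0 nBx) chi1 //; left.
rewrite (chi0 nAx) add0n; have [Bx|nBx] := pselect (B x).
  by rewrite (chi1 Bx) chi1 //; right.
by rewrite (chi0 nBx) chi0 // => -[].
Qed.

End ContinuousFunctions.

Section TypeSemigroup.
Variables (G : Type) (mul : G -> G -> G) (inv : G -> G) (one : G).
Variable act : G -> X -> X.
Hypotheses (groupG : is_group mul inv one) (actG : is_action mul one act).
Implicit Types (f g h k : X -> nat) (s : G) (A : set X).

Lemma act_cts s : continuous (act s).
Proof. by case: actG. Qed.

Lemma actKV s x : act s (act (inv s) x) = x.
Proof.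
case: groupG actG => [_ _ _ _ mulV] [act1 actM _].
by rewrite -actM mulV act1.
Qed.

Lemma actK s x : act (inv s) (act s x) = x.
Proof.
case: groupG actG => [_ _ _ Vmul _] [act1 actM _].
by rewrite -actM Vmul act1.
Qed.

Lemma act_invK s x : act (inv (inv s)) x = act s x.
Proof. by rewrite -{1}(actK s x) actK. Qed.

Lemma act_invM s t x : act (inv (mul s t)) x = act (inv t) (act (inv s) x).
Proof.
have [_ actM _] := actG.
by rewrite -[in RHS](actKV (mul s t) x) actM !actK.
Qed.

Lemma cont_nat_act s f : cont_nat f -> cont_nat (fun x => f (act s x)).
Proof. exact: cont_nat_comp (@act_cts s). Qed.

(* Inductive form of type_rel: transitivity then follows by splitting a single
   piece at a time (equidec_split) instead of refining two decompositions. *)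
Inductive equidec : (X -> nat) -> (X -> nat) -> Prop :=
| equidec0 : equidec (fun=> 0%N) (fun=> 0%N)
| equidec_add s h f g : cont_nat h -> equidec f g ->
    equidec (fun x => (h x + f x)%N) (fun x => (h (act (inv s) x) + g x)%N).

Lemma equidec_cont f g : equidec f g -> cont_nat f /\ cont_nat g.
Proof.
elim=> [|s h {}f {}g ch fg [cf cg]]; first by split; exact: cont_nat_cst.
by split; apply: (@cont_nat_op2 addn) => //; exact: cont_nat_act.
Qed.

Lemma equidecD f g f' g' : equidec f g -> equidec f' g' ->
  equidec (fun x => (f x + f' x)%N) (fun x => (g x + g' x)%N).
Proof.
move=> fg fg'; elim: fg => // s h {}f {}g ch fg IH.
have := equidec_add s ch IH.
by congr equidec; apply: funext => x; rewrite addnA.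
Qed.

Lemma equidec_act s h : cont_nat h -> equidec h (fun x => h (act (inv s) x)).
Proof.
move=> ch; have := equidec_add s ch equidec0.
by congr equidec; apply: funext => x; rewrite addn0.
Qed.

Lemma equidec_refl f : cont_nat f -> equidec f f.
Proof.
move=> cf; have := equidec_act one cf; congr equidec; apply: funext => x.
by rewrite -{2}(actK one x); case: actG => ->.
Qed.

Lemma equidec_sym f g : equidec f g -> equidec g f.
Proof.
elim=> [|s h {}f {}g ch fg IH]; first exact: equidec0.
have := equidec_add (inv s) (cont_nat_act (inv s) ch) IH.
by congr equidec; apply: funext => x; rewrite act_invK actK.
Qed.

(** If [t] moves a piece [h], then [mul t s] moves [h] composed with [act s] to the same place. *)
Lemma equidec_pre_act s f g : equidec f g -> equidec (fun x => f (act s x)) g.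
Proof.
elim=> [|t h {}f {}g ch fg IH]; first exact: equidec0.
have := equidec_add (mul t s) (cont_nat_act s ch) IH.
by congr equidec; apply: funext => x; rewrite act_invM actKV.
Qed.

(** Refinement property. It yields transitivity, and later cuts out of [chi A] the two copies of
    itself that a paradox requires. *)
Lemma equidec_split f g : equidec f g -> forall a b, cont_nat a -> cont_nat b ->
  f = (fun x => (a x + b x)%N) ->
  exists c d, [/\ equidec a c, equidec b d & g = (fun x => (c x + d x)%N)].
Proof.
elim=> [|s h {}f {}g ch fg IH] a b ca cb fab.
  exists (fun=> 0%N), (fun=> 0%N).
  have a0 : a = fun=> 0%N.
    by apply: funext => x; move/(congr1 (@^~ x)): fab => /=; lia.
  have b0 : b = fun=> 0%N.
    by apply: funext => x; move/(congr1 (@^~ x)): fab => /=; lia.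
  by rewrite a0 b0; split => //; exact: equidec0.
(* [a] takes as much of the piece [h] as fits, and [b] the rest. Since [h <= a + b], the rest is at
   most [b], so no subtraction is truncated. *)
pose h1 x := minn (h x) (a x); pose h2 x := (h x - h1 x)%N.
pose a' x := (a x - h1 x)%N; pose b' x := (b x - h2 x)%N.
have ch1 : cont_nat h1 by exact: (@cont_nat_op2 minn).
have ch2 : cont_nat h2 by exact: (@cont_nat_op2 subn).
have ca' : cont_nat a' by exact: (@cont_nat_op2 subn).
have cb' : cont_nat b' by exact: (@cont_nat_op2 subn).
have [|c [d [ac bd gcd]]] := IH _ _ ca' cb'.
  apply: funext => x; move/(congr1 (@^~ x)): fab => /=.
  rewrite /a' /b' /h2 /h1; lia.
exists (fun x => h1 (act (inv s) x) + c x)%N, (fun x => h2 (act (inv s) x) + d x)%N.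
split.
- have := equidec_add s ch1 ac; congr equidec; apply: funext => x.
  rewrite /a' /h1; lia.
- have := equidec_add s ch2 bd; congr equidec; apply: funext => x.
  move/(congr1 (@^~ x)): fab => /=; rewrite /b' /h2 /h1; lia.
- rewrite gcd; apply: funext => x; rewrite /h2 /h1; lia.
Qed.

Lemma equidec_trans g f k : equidec f g -> equidec g k -> equidec f k.
Proof.
move=> fg; elim: fg k => // s h {}f {}g ch fg IH k gk.
have cg := (equidec_cont fg).2.
have [c [d [hc gd ->]]] := equidec_split gk (cont_nat_act (inv s) ch) cg erefl.
apply: equidecD; last exact: IH.
have := equidec_pre_act s hc; congr equidec.
by apply: funext => x; rewrite actK.
Qed.

Lemma equidec_sum n (h : 'I_n -> X -> nat) (s : 'I_n -> G) :
  (forall i, cont_nat (h i)) ->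
  equidec (fun x => \sum_(i < n) h i x)%N
          (fun x => \sum_(i < n) h i (act (inv (s i)) x))%N.
Proof.
move=> ch; elim: n h s ch => [|n IH] h s ch.
  have := equidec0; congr equidec; apply: funext => x; by rewrite big_ord0.
have := equidec_add (s ord0) (ch ord0)
  (IH (h \o lift ord0) (s \o lift ord0) (fun i => ch _)).
by congr equidec; apply: funext => x; rewrite big_ord_recl.
Qed.

Lemma equidecP f g : type_rel inv act f g <-> equidec f g.
Proof.
split=> [[n [h [s [ch fE gE]]]]|].
  have := equidec_sum s ch; congr equidec; exact/esym/funext.
elim=> [|s h {}f {}g ch fg [n [hs [ss [chs fE gE]]]]].
  exists 0%N, (fun _ _ => 0%N), (fun=> one).
  by split => [i|x|x]; [exact: cont_nat_cst|rewrite big_ord0|rewrite big_ord0].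
exists n.+1, (fun i => oapp hs h (unlift ord0 i)).
exists (fun i => oapp ss s (unlift ord0 i)); split => [i|x|x].
- by case: (unliftP ord0 i) => [j _|_] /=.
- rewrite big_ord_recl unlift_none fE /=; congr addn.
  by apply: eq_bigr => i _; rewrite liftK.
- rewrite big_ord_recl unlift_none gE /=; congr addn.
  by apply: eq_bigr => i _; rewrite liftK.
Qed.

(** On continuous functions [equidec] is already an equivalence. Elsewhere the closure contains
    reflexive pairs that [equidec] lacks, hence the hypothesis on [f]. *)
Lemma W_equivP f g : cont_nat f -> W_equiv inv act f g <-> equidec f g.
Proof.
move=> cf; split=> [fg|/equidecP fg]; last exact: rst_step.
(* The induction also carries continuity both ways, because the intermediate functions of a chain
   come with no hypothesis. *)
suff : (cont_nat f <-> cont_nat g) /\ (cont_nat f -> equidec f g).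
  by move=> [_]; exact.
elim: fg {cf} => {f g} [f g /equidecP fg|f|f g _ [fg IH]|f g h _ [fg IH] _ [gh IH']].
- by have [] := equidec_cont fg.
- by split => //; exact: equidec_refl.
- by split; [exact: iff_sym|move=> cg; apply: equidec_sym; apply: IH; exact/fg].
- split; first exact: iff_trans gh.
  by move=> cf; apply: equidec_trans (IH cf) _; apply: IH'; exact/fg.
Qed.

Lemma W_leP f g : cont_nat f ->
  W_le inv act f g <->
  exists c, cont_nat c /\ equidec (fun x => f x + c x)%N g.
Proof.
by move=> cf; split=> -[c [cc fcg]]; exists c; split => //;
  apply/W_equivP => //; exact: (@cont_nat_op2 addn).
Qed.

Lemma equidec_W_le f g h : equidec f g -> cont_nat h ->
  (forall x, g x <= h x)%N -> W_le inv act f h.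
Proof.
move=> fg chh gh; have [cf cg] := equidec_cont fg.
have cc : cont_nat (fun x => h x - g x)%N by exact: (@cont_nat_op2 subn).
apply/(W_leP _ cf); exists (fun x => h x - g x)%N; split => //.
have := equidecD fg (equidec_refl cc); congr equidec; apply: funext => x.
by rewrite subnKC.
Qed.

Lemma W_le_pointwise f h : cont_nat f -> cont_nat h ->
  (forall x, f x <= h x)%N -> W_le inv act f h.
Proof. by move=> cf; apply: equidec_W_le; exact: equidec_refl. Qed.

Lemma W_le_trans g f h : cont_nat f ->
  W_le inv act f g -> W_le inv act g h -> W_le inv act f h.
Proof.
move=> cf /(W_leP _ cf)[c [cc fcg]]; have cg := (equidec_cont fcg).2.
move=> /(W_leP _ cg)[d [cd gdh]].
apply/(W_leP _ cf); exists (fun x => c x + d x)%N; split.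
  exact: (@cont_nat_op2 addn).
apply: equidec_trans gdh.
have := equidecD fcg (equidec_refl cd); congr equidec; apply: funext => x.
by rewrite addnA.
Qed.

Lemma W_leD f g f' g' : cont_nat f -> cont_nat f' ->
  W_le inv act f g -> W_le inv act f' g' ->
  W_le inv act (fun x => f x + f' x)%N (fun x => g x + g' x)%N.
Proof.
move=> cf cf' /(W_leP _ cf)[c [cc fcg]] /(W_leP _ cf')[d [cd fdg]].
have cff : cont_nat (fun x => f x + f' x)%N by exact: (@cont_nat_op2 addn).
apply/(W_leP _ cff); exists (fun x => c x + d x)%N; split.
  exact: (@cont_nat_op2 addn).
have := equidecD fcg fdg; congr equidec; apply: funext => x.
by rewrite addnACA.
Qed.

End TypeSemigroup.

(** * Tarski's theorem for commutative monoids *)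

Section TarskiState.
Local Open Scope ring_scope.
Variables (M : nmodType) (u : M).
Implicit Types (x y z w : M) (le : M -> M -> Prop).

(** Reflexivity is implied: translate [le 0 0]. The last clause says that no multiple of [u] absorbs
    a further copy of [u]. *)
Definition tarski_preorder le :=
  [/\ forall x y z, le x y -> le y z -> le x z,
      forall x y z, le x y -> le (x + z) (y + z),
      forall x, le 0 x &
      forall n, ~ le (u *+ n.+1) (u *+ n)].

Section GoodPreorder.
Variable le : M -> M -> Prop.
Hypothesis gle : tarski_preorder le.

Let pre_trans : forall y x z, le x y -> le y z -> le x z.
Proof. by case: gle => + _ _ _ y x z; exact. Qed.

Let le_add2r z x y : le x y -> le (x + z) (y + z).
Proof. by case: gle => _ + _ _; exact. Qed.

Let le0 x : le 0 x.
Proof. by case: gle. Qed.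

Let le_refl x : le x x.
Proof. by have := le_add2r x (le0 0); rewrite add0r. Qed.

Let le_add x y x' y' : le x y -> le x' y' -> le (x + x') (y + y').
Proof.
move=> xy xy'; apply: (@pre_trans (y + x')); first exact: le_add2r.
by rewrite ![y + _]addrC; exact: le_add2r.
Qed.

Let le_addr x w : le x (x + w).
Proof. by rewrite -{1}[x]addr0; exact: le_add. Qed.

Let le_mulrn n x y : le x y -> le (x *+ n) (y *+ n).
Proof.
by move=> xy; elim: n => [|n IH]; [rewrite !mulr0n|rewrite !mulrS; exact: le_add].
Qed.

Let le_unit m n : (m <= n)%N -> le (u *+ m) (u *+ n).
Proof. by move=> mn; rewrite -(subnKC mn) mulrnDr. Qed.

(** If [b < a], iterating the relation gives [(b + j)u + w <= bu + w] for all [j]. With [j = K + 1]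
    and [w <= Ku] this becomes [(b + K + 1)u <= (b + K)u], which is excluded. *)
Lemma tarski_preorder_cancel a b K w : le w (u *+ K) ->
  le (u *+ a + w) (u *+ b + w) -> (a <= b)%N.
Proof.
move=> wK ab; rewrite leqNgt; apply/negP => ba.
have step j : le (u *+ (b + j) + w) (u *+ b + w).
  elim: j => [|j IH]; first by rewrite addn0.
  apply: pre_trans IH; rewrite addnS -addSn !mulrnDr !(addrAC _ (u *+ j)).
  apply: le_add2r; apply: pre_trans ab; apply: le_add2r; exact: le_unit.
have [_ _ _ /(_ (b + K)%N)] := gle; apply.
apply: (@pre_trans (u *+ b + w)); last by rewrite mulrnDr; exact: le_add.
rewrite -addnS; exact: pre_trans (le_addr _ _) (step _).
Qed.

Lemma tarski_preorder_unit a b : le (u *+ a) (u *+ b) -> (a <= b)%N.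
Proof.
move=> ab; apply: (@tarski_preorder_cancel a b 0 0); first exact: le0.
by rewrite !addr0.
Qed.

Definition unit_bounded x := exists K, le x (u *+ K).

Lemma unit_bounded_muln n x : unit_bounded x -> unit_bounded (x *+ n).
Proof. by move=> [K xK]; exists (K * n)%N; rewrite mulrnA; exact: le_mulrn. Qed.

Lemma unit_boundedD x y :
  unit_bounded (x + y) <-> unit_bounded x /\ unit_bounded y.
Proof.
split=> [[K xyK]|[[K xK] [L yL]]].
  by split; exists K; apply: pre_trans xyK => //; rewrite addrC.
by exists (K + L)%N; rewrite mulrnDr; exact: le_add.
Qed.

(** The cone of [le] enlarged by [y - x], written without subtraction: [b - a] dominates [k(y - x)].
    The case [k = 0] recovers [le], and [k = 1] gives [x <= y]. *)
Definition adjoin_le x y a b := exists k, le (a + y *+ k) (b + x *+ k).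

Lemma tarski_adjoin_le x y :
  (forall n, ~ adjoin_le x y (u *+ n.+1) (u *+ n)) ->
  tarski_preorder (adjoin_le x y).
Proof.
move=> good; split => // [a b c [k ab] [l bc]|a b c [k ab]|a].
- exists (k + l)%N; rewrite !mulrnDr !addrA.
  apply: (@pre_trans (b + x *+ k + y *+ l)); first exact: le_add2r.
  rewrite addrAC; rewrite -[c + _ + _]addrA [x *+ k + _]addrC addrA.
  exact: le_add2r.
- by exists k; rewrite !(addrAC _ c); exact: le_add2r.
- by exists 0%N; rewrite !mulr0n !addr0.
Qed.

(** Add [l] times the first relation to [k] times the second: the terms in [x] and [y] agree on both
    sides and cancel, leaving [l + k <= 0]. With [k = 0] the first relation already contradicts the
    choice of [le]. *)
Lemma adjoin_le_inconsistent x y n m : unit_bounded x -> unit_bounded y ->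
  adjoin_le x y (u *+ n.+1) (u *+ n) -> adjoin_le y x (u *+ m.+1) (u *+ m) ->
  False.
Proof.
move=> bx by_ [k nk] [l ml].
have [K wK] : unit_bounded (x *+ (k * l) + y *+ (k * l)).
  by apply/unit_boundedD; split; exact: unit_bounded_muln.
have : ((n.+1 * l + m.+1 * k) <= n * l + m * k)%N.
  apply: (tarski_preorder_cancel wK).
  have := le_add (le_mulrn l nk) (le_mulrn k ml).
  rewrite !mulrnDl -!mulrnA [(l * k)%N]mulnC.
  rewrite [in X in le X _]addrACA [in X in le _ X]addrACA -!mulrnDr.
  by rewrite [y *+ _ + x *+ _]addrC.
have [k0|k0] := posnP k.
  move: nk; rewrite k0 !mulr0n !addr0 => nu _.
  by have [_ _ _ /(_ n)] := gle.
by lia.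
Qed.

End GoodPreorder.

(** * Maximal preorders and their totality on bounded elements *)

Lemma exists_total_tarski_preorder le0 : tarski_preorder le0 ->
  exists le, [/\ tarski_preorder le, forall x y, le0 x y -> le x y &
    forall x y, unit_bounded le x -> unit_bounded le y -> le x y \/ le y x].
Proof.
move=> g0.
pose rel (A : set (M * M)) x y := A (x, y).
pose P := [set A : set (M * M) | A = set0 \/
  tarski_preorder (rel A) /\ (forall x y, le0 x y -> A (x, y))].
have [F FP totF|A [PA maxA]] := @Zorn_bigcup _ P.
  have [[A FA nA]|noA] := pselect (exists2 A, F A & A !=set0); last first.
    left; apply/seteqP; split => // p [A FA Ap]; apply: noA; exists A => //.
    by exists p.
  right.
  have gF B p : F B -> B p ->
      tarski_preorder (rel B) /\ (forall x y, le0 x y -> B (x, y)).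
    by move=> FB Bp; have [B0|] := FP _ FB; first by move: Bp; rewrite B0.
  have [p Ap] := nA; have [[Atr Aadd A0 An] Asub] := gF A p FA Ap.
  split; last by move=> x y xy; exists A => //; exact: Asub.
  split.
  - move=> x y z [B FB Bxy] [C FC Cyz].
    have [[Btr _ _ _] _] := gF _ _ FB Bxy; have [[Ctr _ _ _] _] := gF _ _ FC Cyz.
    have [BC|CB] := totF _ _ FB FC.
      by exists C => //; apply: Ctr Cyz; exact: BC.
    by exists B => //; apply: Btr Bxy _; exact: CB.
  - move=> x y z [B FB Bxy]; have [[_ Badd _ _] _] := gF _ _ FB Bxy.
    by exists B => //; exact: Badd.
  - by move=> x; exists A => //; exact: A0.
  - move=> n [B FB Bn]; have [[_ _ _ Bgood] _] := gF _ _ FB Bn.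
    exact: Bgood Bn.
(* Maximality restated: an admissible preorder that extends [A] adds no pair. *)
have maxA' le : tarski_preorder le -> (forall x y, le0 x y -> le x y) ->
    (forall x y, A (x, y) -> le x y) -> forall x y, le x y -> A (x, y).
  move=> gle sub0 subA x y xy; apply: contrapT => nAxy.
  apply: (maxA [set p | le p.1 p.2]); last by right.
  split; first by move=> [a b]; exact: subA.
  by move/(_ (x, y) xy).
have [gA subA] : tarski_preorder (rel A) /\ (forall x y, le0 x y -> A (x, y)).
  case: PA => // A0; split; last by apply: maxA' => // x y; rewrite A0.
  have -> // : rel A = le0.
  apply/funext => x; apply/funext => y; apply/propext; split.
    by rewrite /rel A0.
  by apply: maxA' => // {}x {}y; rewrite A0.
exists (rel A); split => // x y bx by_.
(* Adjoining a missing pair must break the last clause of [tarski_preorder], by maximality. Two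
   incomparable elements would break it in both directions, which is inconsistent. *)
have adj a b : ~ rel A a b ->
    exists n, adjoin_le (rel A) a b (u *+ n.+1) (u *+ n).
  move=> nab; apply: contrapT => /forallNP good; apply: nab.
  apply: (maxA' _ (tarski_adjoin_le gA good)).
  - by move=> c d cd; exists 0%N; rewrite !mulr0n !addr0; exact: subA.
  - by move=> c d cd; exists 0%N; rewrite !mulr0n !addr0.
  - exists 1%N; rewrite !mulr1n addrC; have [_ Aadd A0 _] := gA.
    by have := Aadd _ _ (b + a) (A0 0); rewrite !add0r.
have [|nxy] := pselect (rel A x y); first by left.
have [|nyx] := pselect (rel A y x); first by right.
have [n xyn] := adj _ _ nxy; have [m yxm] := adj _ _ nyx.
by have := adjoin_le_inconsistent gA bx by_ xyn yxm.
Qed.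

(** * The state defined by a total preorder *)

Section State.
Variables (R : realType) (le : M -> M -> Prop).
Hypothesis gle : tarski_preorder le.
Hypothesis le_total : forall x y,
  unit_bounded le x -> unit_bounded le y -> le x y \/ le y x.

Let pre_trans : forall y x z, le x y -> le y z -> le x z.
Proof. by case: gle => + _ _ _ y x z; exact. Qed.

Let le0 x : le 0 x.
Proof. by case: gle. Qed.

Let le_refl x : le x x.
Proof. by case: gle => _ /(_ _ _ x (le0 0)) + _ _; rewrite add0r. Qed.

Let le_add x y x' y' : le x y -> le x' y' -> le (x + x') (y + y').
Proof.
have [_ add _ _] := gle.
move=> xy xy'; apply: (@pre_trans (y + x')); first exact: add.
by rewrite ![y + _]addrC; exact: add.
Qed.

Let le_mulrn n x y : le x y -> le (x *+ n) (y *+ n).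
Proof.
by move=> xy; elim: n => [|n IH]; [rewrite !mulr0n|rewrite !mulrS; exact: le_add].
Qed.

Let ratios x : set R := [set r | exists m k,
  [/\ (0 < m)%N, le (x *+ m) (u *+ k) & r = k%:R / m%:R]].

Let ratios_ge0 x : lbound (ratios x) 0.
Proof. by move=> _ [m [k [_ _ ->]]]; rewrite divr_ge0. Qed.

Let ratios_has_inf x : unit_bounded le x -> has_inf (ratios x).
Proof.
move=> [K xK]; split; last by exists 0; exact: ratios_ge0.
by exists (K%:R / 1%:R); exists 1%N, K; rewrite mulr1n.
Qed.

Let inf_le x m k : (0 < m)%N -> le (x *+ m) (u *+ k) ->
  inf (ratios x) <= k%:R / m%:R.
Proof.
move=> m0 xk; apply: ge_inf; first by exists 0; exact: ratios_ge0.
by exists m, k.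
Qed.

Let unit_bounded_unit k : unit_bounded le (u *+ k).
Proof. by exists k. Qed.

Let approx x N : unit_bounded le x ->
  exists a, le (u *+ a) (x *+ N) /\ le (x *+ N) (u *+ a.+1).
Proof.
move=> bx; have bxN := unit_bounded_muln gle N bx.
have ex : exists a, `[< le (x *+ N) (u *+ a.+1) >].
  have [K xK] := bxN; exists K; apply/asboolP; apply: pre_trans xK _.
  by rewrite mulrS -{1}[_ *+ K]add0r; exact: le_add.
case: (ex_minnP ex) => -[|a] /asboolP xa mina.
  by exists 0%N; rewrite mulr0n.
exists a.+1; split => //.
(* This is where totality enters: the other alternative contradicts the minimality of [a.+1]. *)
have [//|xa'] := le_total (unit_bounded_unit a.+1) bxN.
by have := mina a (asboolT xa'); rewrite ltnn.
Qed.

Let infD x y : unit_bounded le x -> unit_bounded le y ->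
  inf (ratios (x + y)) = inf (ratios x) + inf (ratios y).
Proof.
move=> bx by_.
have bxy : unit_bounded le (x + y) by apply/(unit_boundedD gle).
apply/eqP; rewrite eq_le; apply/andP; split.
  rewrite -lerBlDl; apply: lb_le_inf; first by have [] := ratios_has_inf by_.
  move=> _ [n [l [n0 yl ->]]]; rewrite lerBlDl -lerBlDr.
  apply: lb_le_inf; first by have [] := ratios_has_inf bx.
  move=> _ [m [k [m0 xk ->]]]; rewrite lerBlDr.
  have -> : k%:R / m%:R + l%:R / n%:R = (k * n + l * m)%:R / (m * n)%:R :> R.
    by rewrite !natrD !natrM; field; rewrite !pnatr_eq0 -!lt0n m0 n0.
  apply: inf_le; first by rewrite muln_gt0 m0.
  rewrite mulrnDl mulrnDr mulrnA [(m * n)%N]mulnC !mulrnA.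
  by apply: le_add; exact: le_mulrn.
apply: lb_le_inf; first by have [] := ratios_has_inf bxy.
move=> _ [m [K [m0 xyK ->]]]; rewrite leNgt; apply/negP => /ltr_add_invr[j].
apply/negP; rewrite -leNgt.
(* Both [x] and [y] are bracketed between consecutive multiples of [u] at scale [N]. The lower
   bounds give [(a + b)m <= KN], and rounding up twice costs [2 / N], which is the gap
   [1 / (j + 1)]. *)
have [N N0 NE] : exists2 N, (0 < N)%N & N = (2 * j.+1)%N.
  by exists (2 * j.+1)%N.
have [a [ax xa]] := approx N bx; have [b [by_' yb]] := approx N by_.
apply: le_trans (lerD (inf_le N0 xa) (inf_le N0 yb)) _.
have : ((a + b) * m <= K * N)%N.
  apply: (tarski_preorder_unit gle).
  apply: (@pre_trans ((x + y) *+ (N * m))).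
    by rewrite !mulrnA mulrnDr mulrnDl; apply: le_mulrn; exact: le_add.
  by rewrite mulnC !mulrnA; exact: le_mulrn.
rewrite -(ler_nat R) => abK.
have m0' : 0 < m%:R :> R by rewrite ltr0n.
have -> : a.+1%:R / N%:R + b.+1%:R / N%:R =
   ((a + b) * m)%:R / (N%:R * m%:R) + j.+1%:R^-1 :> R.
  rewrite NE !natrM natrD -!natr1.
  by field; rewrite natr1 pnatr_eq0 lt0r_neq0.
rewrite lerD2r ler_pdivrMr ?mulr_gt0 ?ltr0n//.
rewrite (le_trans abK)// natrM [leRHS](_ : _ = K%:R * N%:R)//.
by field; rewrite lt0r_neq0.
Qed.

(** Elements below no multiple of [u] get the value [+oo], which keeps the function monotone and
    additive. *)
Let state x : \bar R :=
  if `[< unit_bounded le x >] then (inf (ratios x))%:E else +oo%E.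

Let state_bounded x : unit_bounded le x -> state x = (inf (ratios x))%:E.
Proof. by rewrite /state; case: asboolP. Qed.

Let state_unbounded x : ~ unit_bounded le x -> state x = +oo%E.
Proof. by rewrite /state; case: asboolP. Qed.

Lemma total_tarski_preorder_state : exists nu : M -> \bar R,
  [/\ forall x, (0 <= nu x)%E, forall x y, le x y -> (nu x <= nu y)%E,
      forall x y, nu (x + y) = (nu x + nu y)%E, nu 0 = 0%E & nu u = 1%E].
Proof.
exists state; split.
- move=> x; have [bx|bx] := pselect (unit_bounded le x).
    rewrite state_bounded// lee_fin; apply: lb_le_inf; last exact: ratios_ge0.
    by have [] := ratios_has_inf bx.
  by rewrite state_unbounded// leey.
- move=> x y xy; have [by_|by_] := pselect (unit_bounded le y); last first.
    by rewrite (state_unbounded by_) leey.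
  have bx : unit_bounded le x by have [K yK] := by_; exists K; exact: pre_trans yK.
  rewrite !state_bounded// lee_fin; apply: lb_le_inf.
    by have [] := ratios_has_inf by_.
  move=> _ [m [k [m0 yk ->]]]; apply: inf_le => //.
  by apply: pre_trans yk; exact: le_mulrn.
- move=> x y; have [bxy|bxy] := pselect (unit_bounded le (x + y)).
    have [bx by_] := proj1 (unit_boundedD gle x y) bxy.
    by rewrite !state_bounded// infD.
  rewrite (state_unbounded bxy).
  have [bx|bx] := pselect (unit_bounded le x); last first.
    rewrite (state_unbounded bx) addye//; rewrite /state; case: ifP => //.
  have by_ : ~ unit_bounded le y.
    by move=> by_; apply: bxy; apply/(unit_boundedD gle).
  by rewrite (state_unbounded by_) state_bounded.
- rewrite state_bounded; last by exists 0%N.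
  congr (_%:E); apply/eqP; rewrite eq_le; apply/andP; split.
    by have := @inf_le 0 1 0 isT; rewrite mul0r; apply; rewrite mul0rn.
  apply: lb_le_inf; last exact: ratios_ge0.
  by have [] : has_inf (ratios 0) by apply: ratios_has_inf; exists 0%N.
- have bu : unit_bounded le u by exists 1%N; rewrite mulr1n.
  rewrite state_bounded//; congr (_%:E); apply/eqP; rewrite eq_le; apply/andP.
  split; first by have := @inf_le u 1 1 isT; rewrite divr1; apply.
  apply: lb_le_inf; first by have [] := ratios_has_inf bu.
  move=> _ [m [k [m0 uk ->]]].
  by rewrite ler_pdivlMr ?ltr0n// mul1r ler_nat; exact: (tarski_preorder_unit gle).
Qed.

End State.

Theorem tarski_state (R : realType) (le : M -> M -> Prop) :
  tarski_preorder le -> exists nu : M -> \bar R,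
  [/\ forall x, (0 <= nu x)%E, forall x y, le x y -> (nu x <= nu y)%E,
      forall x y, nu (x + y) = (nu x + nu y)%E, nu 0 = 0%E & nu u = 1%E].
Proof.
move=> /exists_total_tarski_preorder[le' [gle' sub tot]].
have [nu [nu0 nule nuD nu00 nu1]] := total_tarski_preorder_state R gle' tot.
by exists nu; split => // x y /sub; exact: nule.
Qed.

End TarskiState.

(** * Extending finitely additive functions from clopen to Borel sets *)

(** A second copy of the Cantor set, whose measurable sets are the clopen ones, as the domain of the
    premeasure; [BorelX] carries the extension. *)
Definition clopen_ring : Type := X.

HB.instance Definition _ := Pointed.on clopen_ring.

Lemma setD_closed_clopen : setD_closed (@clopen X).
Proof. by move=> A B cA cB; rewrite setDE; apply: clopenI => //; exact: clopenC. Qed.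

HB.instance Definition _ := @isRingOfSets.Build default_measure_display
  clopen_ring (@clopen X) clopen0 clopenU setD_closed_clopen.

Section MeasureFromClopen.
Local Open Scope ereal_scope.
Variables (R : realType) (nu : set clopen_ring -> \bar R).
Hypotheses (nu0 : nu set0 = 0) (nu_ge0 : forall A, 0 <= nu A).
Hypothesis nuU : forall A B, clopen A -> clopen B -> A `&` B = set0 ->
  nu (A `|` B) = nu A + nu B.

(** A clopen union of disjoint clopen sets is compact, so finitely many of them already exhaust it
    and the partial sums are eventually constant. *)
Lemma clopen_semi_sigma_additive : semi_sigma_additive nu.
Proof.
move=> F cF tF cUF.
pose U n := \big[setU/set0]_(0 <= i < n) F i.
have UE n x : U n x <-> exists2 i, (i < n)%N & F i x.
  elim: n => [|n IH]; first by rewrite /U big_geq//; split => // -[].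
  rewrite /U big_nat_recr//=; split.
    by move=> [/IH[i ni Fx]|Fx]; [exists i => //; exact: ltnW|exists n].
  move=> [i]; rewrite ltnS leq_eqVlt => /orP[/eqP -> ?|ni ?]; first by right.
  by left; apply/IH; exists i.
have cU n : clopen (U n).
  elim: n => [|n IH]; first by rewrite /U big_geq//; exact: clopen0.
  by rewrite /U big_nat_recr//=; apply: clopenU => //; exact: cF.
have nuUn n : nu (U n) = \sum_(0 <= i < n) nu (F i).
  elim: n => [|n IH]; first by rewrite /U !big_geq.
  rewrite [RHS]big_nat_recr//= -IH -nuU//; last 2 first.
  - exact: cF.
  - apply/seteqP; split => // x [/UE[i ni Fix] Fnx].
    have : i = n by apply: (tF i n I I); exists x.
    by move=> ni'; rewrite ni' ltnn in ni.
  by rewrite /U big_nat_recr.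
have [||||N FN] := @compact_increasing_cover (\bigcup_n F n) U.
- by case: cUF.
- by move=> n; case: (cU n).
- by move=> m n mn x /UE[i im Fx]; apply/UE; exists i => //; exact: leq_trans mn.
- by move=> x [i _ Fx]; exists i.+1 => //; apply/UE; exists i.
apply: cvg_near_cst; exists N => // n /= Nn.
rewrite -nuUn; congr nu; apply/seteqP; split => [x /UE[i _ ?]|x /FN /UE[i iN ?]].
  by exists i.
by apply/UE; exists i => //; exact: leq_trans Nn.
Qed.

HB.instance Definition _ := isMeasure.Build _ clopen_ring R nu nu0 nu_ge0
  clopen_semi_sigma_additive.

(** Every open set is a countable union of clopen sets, so the Borel sets lie in the domain of the
    Caratheodory extension. *)
Lemma borel_measurable_clopen (A : set BorelX) : measurable A ->
  <<s @clopen X >> A.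
Proof.
apply: smallest_sub; first exact: smallest_sigma_algebra.
move=> O /open_bigcup_clopen[U [cU ->]].
have [_ _ Ubig] := smallest_sigma_algebra setT (@clopen X).
by apply: Ubig => i; apply: sub_sigma_algebra.
Qed.

Let mu : set BorelX -> \bar R := mu_ext nu.

Let mu0 : mu set0 = 0. Proof. exact: mu_ext0. Qed.
Let mu_ge0 A : 0 <= mu A. Proof. exact: mu_ext_ge0. Qed.
Let mu_semi_sigma_additive : semi_sigma_additive mu.
Proof.
move=> F mF tF mUF.
apply: (@measure_semi_sigma_additive _ _ _ (@measure_extension _ _ _ nu) F) => //.
  by move=> i; exact: borel_measurable_clopen.
exact: borel_measurable_clopen.
Qed.
HB.instance Definition _ := isMeasure.Build _ BorelX R mu mu0 mu_ge0
  mu_semi_sigma_additive.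

(** A clopen cover of [A] pulls back along [psi] to a clopen cover of the preimage with the same
    total [nu], so the infima compare. *)
Lemma mu_ext_preimage (phi psi : X -> X) (A : set X) : cancel phi psi ->
  continuous psi ->
  (forall B, clopen B -> nu (psi @^-1` B) = nu B) ->
  mu (psi @^-1` A) <= mu A.
Proof.
move=> phiK cpsi nupsi; apply: le_ereal_inf_tmp => _ [B [mB AB] <-].
apply: ereal_inf_lbound; exists (fun k => psi @^-1` (B k)).
  split => [k|x /AB[k _ Bk]]; last by exists k.
  exact: preimage_clopen (mB k) cpsi.
by apply: eq_eseriesr => k _; rewrite nupsi//; exact: mB.
Qed.

Theorem exists_borel_extension (G : Type) (act : G -> X -> X) (inv : G -> G) :
  (forall s, continuous (act s)) ->
  (forall s, cancel (act s) (act (inv s))) ->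
  (forall s, cancel (act (inv s)) (act s)) ->
  (forall s A, clopen A -> nu (act s @^-1` A) = nu A) ->
  exists m : measure BorelX R, invariant_measure act m /\
    forall A, clopen A -> m A = nu A.
Proof.
move=> cact actK actVK nuact; exists mu; split => [s A _|A cA]; last first.
  exact: (@measurable_mu_extE _ _ _ nu).
apply/eqP; rewrite eq_le; apply/andP; split.
  exact: mu_ext_preimage (actVK s) (cact s) (nuact s).
(* The reverse inequality is the same estimate for [inv s], applied to the preimage of [A]. *)
rewrite [leLHS](_ : _ = mu (act (inv s) @^-1` (act s @^-1` A))).
  exact: mu_ext_preimage (actK s) (cact (inv s)) (nuact (inv s)).
by congr mu; apply/seteqP; split => x /=; rewrite actVK.
Qed.

End MeasureFromClopen.

(** * The equivalence *)

Record cfun := CFun { cfun_val : X -> nat; cfun_cont : cont_nat cfun_val }.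

HB.instance Definition _ := gen_eqMixin cfun.
HB.instance Definition _ := gen_choiceMixin cfun.

Lemma cfun_inj (f g : cfun) : cfun_val f =1 cfun_val g -> f = g.
Proof.
case: f g => [f cf] [g cg] /= /funext fg; move: cf cg; rewrite fg => cf cg.
by congr CFun; exact: Prop_irrelevance.
Qed.

Definition cfun_zero := CFun (cont_nat_cst 0).
Definition cfun_add (f g : cfun) :=
  CFun (cont_nat_op2 addn (cfun_cont f) (cfun_cont g)).

Lemma cfun_addA : associative cfun_add.
Proof. by move=> f g h; apply: cfun_inj => x /=; rewrite addnA. Qed.

Lemma cfun_addC : commutative cfun_add.
Proof. by move=> f g; apply: cfun_inj => x /=; rewrite addnC. Qed.

Lemma cfun_add0 : left_id cfun_zero cfun_add.
Proof. by move=> f; apply: cfun_inj. Qed.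

(** Tarski's theorem is applied to this monoid of functions instead of its quotient;
    equidecomposability enters through the preorder [W_le]. *)
HB.instance Definition _ := GRing.isNmodule.Build cfun cfun_addA cfun_addC cfun_add0.

Lemma cfun_mulrn (f : cfun) n : cfun_val (f *+ n)%R = fun x => (n * cfun_val f x)%N.
Proof.
apply: funext => x; elim: n => [|n IH]; first by rewrite mulr0n.
by rewrite mulrS /= IH mulSn.
Qed.

Section Main.
Variables (R : realType) (G : Type) (mul : G -> G -> G) (inv : G -> G) (one : G).
Variable act : G -> X -> X.
Hypotheses (groupG : is_group mul inv one) (actG : is_action mul one act).
Implicit Types (A F O : set X) (f : X -> nat).

(** Otherwise [W_le] is a Tarski preorder with unit [chi A], and the resulting invariant Borel
    measure gives the clopen set [A] measure 1. *)
Lemma almost_properly_infinite A : clopen A ->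
  (forall mu : measure BorelX R,
    invariant_measure act mu -> ~ nontrivial_measure mu) ->
  exists n, W_le inv act (fun x => n.+1 * chi A x)%N (fun x => n * chi A x)%N.
Proof.
move=> cA nomu; apply: contrapT => /forallNP An.
pose u := CFun (cont_nat_chi cA).
pose le (f g : cfun) := W_le inv act (cfun_val f) (cfun_val g).
have le_pw (f g : cfun) : (forall x, cfun_val f x <= cfun_val g x)%N -> le f g.
  exact: (W_le_pointwise groupG actG (cfun_cont f) (cfun_cont g)).
have gle : tarski_preorder u le.
  split.
  - by move=> f g h; exact: (W_le_trans groupG actG (cfun_cont f)).
  - move=> f g h fg.
    by apply: (W_leD groupG actG (cfun_cont f) (cfun_cont h) fg); exact: le_pw.
  - by move=> f; exact: le_pw.
  - by move=> n; rewrite /le !cfun_mulrn; exact: An.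
have [st [st0 st_le stD st00 stu]] := tarski_state R gle.
(* The value 0 off the clopen sets is a default; only clopen sets are measurable in
   [clopen_ring]. *)
pose nu B := if pselect (clopen B) is left cB
  then st (CFun (cont_nat_chi cB)) else 0%E.
have nuE B (cB : clopen B) : nu B = st (CFun (cont_nat_chi cB)).
  by rewrite /nu; case: pselect => // cB'; congr st; exact: cfun_inj.
have nu0 : nu set0 = 0%E.
  rewrite (nuE _ clopen0) -st00; congr st; apply: cfun_inj => x /=.
  by rewrite chi0.
have nu_ge0 B : (0 <= nu B)%E by rewrite /nu; case: pselect.
have nuU B C : clopen B -> clopen C -> B `&` C = set0 ->
    nu (B `|` C) = (nu B + nu C)%E.
  move=> cB cC BC; rewrite (nuE _ cB) (nuE _ cC) (nuE _ (clopenU cB cC)) -stD.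
  by congr st; apply: cfun_inj => x /=; rewrite chiU.
have nuact s B : clopen B -> nu (act s @^-1` B) = nu B.
  move=> cB; have csB : clopen (act s @^-1` B).
    by apply: preimage_clopen => // x; exact: (act_cts actG).
  rewrite (nuE _ cB) (nuE _ csB); apply/eqP; rewrite eq_le.
  have sBB : equidec inv act (chi (act s @^-1` B)) (chi B).
    have := equidec_act inv act s (cont_nat_chi csB); congr equidec.
    apply: funext => x; congr (nat_of_bool _); apply: asbool_equiv_eq.
    by rewrite /preimage /= (actKV groupG actG).
  (* [st] is monotone for [le], so each direction of [sBB] gives one inequality. *)
  apply/andP; split; apply: st_le.
    exact: (equidec_W_le groupG actG sBB (cont_nat_chi cB)).
  exact: (equidec_W_le groupG actG (equidec_sym groupG actG sBB)
            (cont_nat_chi csB)).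
have [m [invm mE]] := exists_borel_extension nu0 nu_ge0 nuU (act_cts actG)
  (actK groupG actG) (actKV groupG actG) nuact.
apply: (nomu m invm); exists A; split => //.
rewrite mE// (nuE _ cA) -/u stu; split; first exact: lte01.
exact: ltry.
Qed.

(** * Subequivalence of sets and equidecomposability of indicators *)

Lemma equidec_subequiv A O k : equidec inv act (chi A) k ->
  (forall x, k x <= chi O x)%N -> subequiv act A O.
Proof.
move=> /(equidecP _ one)[n [h [s [ch AE kE]]]] kO.
have kh i x : (h i x <= k (act (s i) x))%N.
  by rewrite kE (bigD1 i)//= (actK groupG actG) leq_addr.
(* The supports of the pieces serve as the open sets. *)
exists n, (fun i => h i @^-1` [set m | (0 < m)%N]), s; split.
- by move=> i; have [] := cont_nat_preimage [set m | (0 < m)%N] (ch i).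
- move=> x /chi1; rewrite AE => hx; apply: contrapT => nU.
  have : \sum_(i < n) h i x = 0%N.
    apply: big1 => i _; apply/eqP; rewrite -leqn0 leqNgt; apply/negP => hi.
    by apply: nU; exists i.
  by rewrite hx.
- move=> i _ [x /= hx <-]; apply/chi_gt0.
  by apply: leq_trans (kO _); apply: leq_trans (kh i x).
- move=> i j ij; apply/seteqP; split => // _ [[x /= hx <-] [y /= hy yx]].
  (* A point in both images would be counted twice by [k], against [k <= chi O <= 1]. *)
  have := kO (act (s i) x); rewrite kE (bigD1 i)//= (bigD1 j)/=; last by rewrite eq_sym.
  rewrite (actK groupG actG) -yx (actK groupG actG).
  have : (chi O (act (s j) y) <= 1)%N by exact: leq_b1.
  rewrite /= in hx hy; lia.
Qed.

Lemma sum_chi_disjoint n (B : 'I_n -> set X) x :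
  (forall i j, i != j -> B i `&` B j = set0) ->
  (\sum_(i < n) chi (B i) x)%N = chi (\bigcup_i B i) x.
Proof.
move=> disB; have [[i _ Bix]|nBx] := pselect ((\bigcup_i B i) x).
  rewrite chi1; last by exists i.
  rewrite (bigD1 i)//= chi1// big1// => j ji; apply: chi0 => Bjx.
  by have : (B j `&` B i) x by []; rewrite disB.
by rewrite chi0// big1// => i _; apply: chi0 => Bix; apply: nBx; exists i.
Qed.

(** A Lebesgue depth refines the open cover to a clopen partition of [A]. Its indicators are the
    pieces, and their disjoint translates add up to the indicator of a subset of [O]. *)
Lemma subequiv_equidec A O : clopen A -> subequiv act A O ->
  exists2 k, equidec inv act (chi A) k & forall x, (k x <= chi O x)%N.
Proof.
move=> cA [n [U [s [oU AU sUO disU]]]].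
have [N NU] := cylinder_lebesgue (proj2 cA) oU AU.
(* The chosen index depends only on the depth-[N] cylinder of [x], so its level sets are clopen, and
   they are disjoint. *)
pose idx x := [pick i | `[< cylinder N x `<=` U i >]].
pose V i := A `&` [set x | idx x = Some i].
have VU i : V i `<=` U i.
  move=> x [_ /=]; rewrite /idx; case: pickP => // j /asboolP xU [<-].
  exact: xU.
have AV : A = \bigcup_i V i.
  apply/seteqP; split => [x Ax|x [i _ []]//].
  have [i xUi] := NU x Ax; case E : (idx x) => [j|]; first by exists j.
  by move: E; rewrite /idx; case: pickP => // /(_ i) /asboolP.
have cV i : clopen (V i).
  apply: clopenI => //; apply: (@finitely_determined_clopen N) => x y xy /= <-.
  apply: eq_pick => j; apply: asbool_equiv_eq; split => sub z zN; apply: sub.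
    exact: cylinder_trans (cylinder_sym xy) zN.
  exact: cylinder_trans zN.
exists (fun x => \sum_(i < n) chi (V i) (act (inv (s i)) x))%N => [|x].
  have := equidec_sum inv act s (fun i => cont_nat_chi (cV i)); congr equidec.
  apply: funext => x; rewrite sum_chi_disjoint -?AV// => i j ij.
  apply/seteqP; split => // y [[_ /= yi] [_ /= yj]].
  by move: yj ij; rewrite yi => -[->]; rewrite eqxx.
have imV i : act (inv (s i)) @^-1` V i `<=` act (s i) @` U i.
  move=> y /VU Uy; exists (act (inv (s i)) y) => //.
  exact: (actKV groupG actG).
have -> : (\sum_(i < n) chi (V i) (act (inv (s i)) x))%N =
    chi (\bigcup_i act (inv (s i)) @^-1` V i) x.
  rewrite -sum_chi_disjoint// => i j ij; apply/seteqP; split => // y [Viy Vjy].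
  by rewrite -(disU i j ij); split; exact: imV.
have [[i _ /imV xU]|nx] := pselect ((\bigcup_i act (inv (s i)) @^-1` V i) x).
  by rewrite [leqRHS]chi1 ?leq_b1//; exact: sUO xU.
by rewrite chi0.
Qed.

Lemma subequiv_nonempty A O : A !=set0 -> subequiv act A O -> O !=set0.
Proof.
move=> [x Ax] [n [U [s [_ AU sUO _]]]].
by have [i _ Uix] := AU x Ax; exists (act (s i) x); apply: (sUO i); exists x.
Qed.

Lemma subequivSl A F O : F `<=` A -> subequiv act A O -> subequiv act F O.
Proof.
move=> FA [n [U [s [oU AU sUO disU]]]]; exists n, U, s; split => //.
exact: subset_trans AU.
Qed.

(** * From paradoxical comparison to almost unperforation *)

Lemma paradoxical_comparison_clopen A : paradoxical_comparison act ->
  clopen A -> W_le inv act (fun x => chi A x + chi A x)%N (chi A).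
Proof.
(* The empty set is treated apart, since paradoxical comparison concerns nonempty open sets;
   otherwise take [F = O = A]. *)
move=> pc cA; have [->|/set0P A0] := eqVneq A set0.
  apply: (W_le_pointwise groupG actG);
    [|exact: cont_nat_chi clopen0|by move=> x; rewrite !chi0].
  by apply: (@cont_nat_op2 addn); exact: cont_nat_chi clopen0.
have [P [Q [_ _ [PA QA] PQ [AP AQ]]]] :=
  pc A A (proj1 cA) A0 (proj2 cA) (fun x Ax => Ax).
have [k1 Ak1 k1P] := subequiv_equidec cA AP.
have [k2 Ak2 k2Q] := subequiv_equidec cA AQ.
apply: (equidec_W_le groupG actG (equidecD Ak1 Ak2) (cont_nat_chi cA)) => x.
apply: leq_trans (leq_add (k1P x) (k2Q x)) _.
have -> : (chi P x + chi Q x)%N = chi (P `|` Q) x by rewrite chiU.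
have [[/PA|/QA] Ax|nPQ] := pselect ((P `|` Q) x); last by rewrite chi0.
  by rewrite [leqRHS]chi1 ?leq_b1.
by rewrite [leqRHS]chi1 ?leq_b1.
Qed.

(** Layer-cake argument: a bounded [f] is the sum of the indicators of the clopen sets [f > i], and
    the inequalities for the layers add up. *)
Lemma paradoxical_comparison_double f : paradoxical_comparison act ->
  cont_nat f -> W_le inv act (fun x => f x + f x)%N f.
Proof.
move=> pc cf; have [N fN] := cont_nat_bounded cf.
pose T i := chi (f @^-1` [set m | (i < m)%N]).
have cT i : cont_nat (T i) by apply: cont_nat_chi; exact: cont_nat_preimage.
have TE i x : T i x = (i < f x)%N.
  by congr nat_of_bool; apply/idP/idP => [/set_mem//|?]; apply/mem_set.
pose S n x := (\sum_(i < n) T i x)%N.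
have SE n x : S n x = minn n (f x).
  elim: n => [|n IH]; first by rewrite /S big_ord0 min0n.
  rewrite /S big_ord_recr/= -/(S n x) IH TE; case: ltnP => nf /=; lia.
have -> : f = S N by apply: funext => x; rewrite SE; apply/esym/minn_idPr.
have cS n : cont_nat (S n).
  elim: n => [|n IH].
    rewrite (_ : S 0 = fun=> 0%N); first exact: cont_nat_cst.
    by apply: funext => x; rewrite SE min0n.
  rewrite (_ : S n.+1 = fun x => (S n x + T n x)%N); first exact: (@cont_nat_op2 addn).
  by apply: funext => x; rewrite /S big_ord_recr.
elim: N {fN} => [|n IH].
  apply: (W_le_pointwise groupG actG) => //; first exact: (@cont_nat_op2 addn).
  by move=> x; rewrite SE min0n.
have -> : S n.+1 = fun x => (S n x + T n x)%N.
  by apply: funext => x; rewrite /S big_ord_recr.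
have := W_leD groupG actG _ _ IH
  (paradoxical_comparison_clopen pc (cont_nat_preimage [set m | (n < m)%N] cf)).
rewrite (_ : (fun x => S n x + S n x + (T n x + T n x))%N =
  (fun x => S n x + T n x + (S n x + T n x))%N); last first.
  by apply: funext => x; rewrite addnACA.
by apply; apply: (@cont_nat_op2 addn); first [exact: cS|exact: cT].
Qed.

Lemma paradoxical_almost_unperforated :
  paradoxical_comparison act -> almost_unperforated inv act.
Proof.
move=> pc f g n cf cg n0 fg.
have cmul m h : cont_nat h -> cont_nat (fun x => m * h x)%N.
  by move=> ch; apply: (@cont_nat_op2 muln) => //; exact: cont_nat_cst.
apply: (W_le_trans groupG actG (g := fun x => (n.+1 * f x)%N)) => //.
  by apply: (W_le_pointwise groupG actG) => // [|x]; [exact: cmul|exact: leq_pmull].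
apply: (W_le_trans groupG actG (cmul _ _ cf) fg).
have pw_refl : W_le inv act g g by exact: (W_le_pointwise groupG actG).
(* A positive multiple of [y = [g]] is below [y], by induction:
   [(n+2)y = y + (n+1)y <= y + y <= y]. *)
case: n n0 {fg} => // n _; elim: n => [|n IH].
  by apply: (W_le_pointwise groupG actG) => // [|x]; [exact: cmul|rewrite mul1n].
have cgn : cont_nat (fun x => n.+1 * g x)%N by exact: cmul.
have := W_leD groupG actG cg cgn pw_refl IH.
rewrite (_ : (fun x => g x + n.+1 * g x)%N = (fun x => n.+2 * g x)%N)//.
move=> gn; apply: (W_le_trans groupG actG (cmul _ _ cg) gn).
exact: paradoxical_comparison_double.
Qed.

(** * From almost unperforation to paradoxical comparison *)

Lemma almost_unperforated_double A : almost_unperforated inv act -> clopen A ->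
  (exists n, W_le inv act (fun x => n.+1 * chi A x)%N (fun x => n * chi A x)%N) ->
  W_le inv act (fun x => chi A x + chi A x)%N (chi A).
Proof.
move=> au cA [n nA].
have cmul m : cont_nat (fun x => m * chi A x)%N.
  by apply: (@cont_nat_op2 muln); [exact: cont_nat_cst|exact: cont_nat_chi].
have nj j : W_le inv act (fun x => (n + j) * chi A x)%N (fun x => n * chi A x)%N.
  elim: j => [|j IH].
    by rewrite addn0; exact: (W_le_pointwise groupG actG).
  apply: (W_le_trans groupG actG _ _ IH) => //.
  have jj : W_le inv act (fun x => j * chi A x)%N (fun x => j * chi A x)%N.
    exact: (W_le_pointwise groupG actG).
  have := W_leD groupG actG (cmul _) (cmul _) nA jj.
  under eq_fun do rewrite -mulnDl addSnnS.
  by under [in X in W_le _ _ _ X]eq_fun do rewrite -mulnDl.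
have cchi := cont_nat_chi cA.
apply: (au _ _ n.+1) => //; first exact: (@cont_nat_op2 addn).
(* The shift [n + 4] is chosen so that [n + (n + 4) = 2(n + 2)]. Unperforation is used at [n.+1],
   which is positive even when [n = 0]. *)
have := nj (n + 4)%N.
rewrite (_ : (fun x => _) = (fun x => n.+2 * (chi A x + chi A x))%N); last first.
  by apply: funext => x; lia.
move=> /(W_le_trans groupG actG); apply.
  apply: (@cont_nat_op2 (fun a b => n.+2 * (a + b))%N); exact: cont_nat_chi.
by apply: (W_le_pointwise groupG actG) => // x; rewrite leq_mul2r leqnSn orbT.
Qed.

(** Splitting twice writes [chi A] as [k1 + k2 + d] with [k1] and [k2] each equidecomposable with
    [chi A]. Since the sum is at most 1, their supports are disjoint. *)
Lemma double_paradoxical A : clopen A -> A !=set0 ->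
  W_le inv act (fun x => chi A x + chi A x)%N (chi A) ->
  exists O1 O2 : set X,
    [/\ open O1 /\ open O2, O1 !=set0 /\ O2 !=set0,
        O1 `<=` A /\ O2 `<=` A, O1 `&` O2 = set0 &
        subequiv act A O1 /\ subequiv act A O2].
Proof.
move=> cA A0; have cchi := cont_nat_chi cA.
have cchi2 : cont_nat (fun x => chi A x + chi A x)%N by exact: (@cont_nat_op2 addn).
move=> /(W_leP groupG actG _ cchi2)[c [cc AA]].
have cAc : cont_nat (fun x => chi A x + c x)%N by exact: (@cont_nat_op2 addn).
have [|k1 [k' [Ak1 Ak' AE]]] := equidec_split AA cchi cAc.
  by apply: funext => x; rewrite addnA.
have [k2 [d [Ak2 _ k'E]]] := equidec_split Ak' cchi cc erefl.
have kA x : (k1 x + k2 x <= chi A x)%N by rewrite AE k'E addnA leq_addr.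
have chi_le1 x : (chi A x <= 1)%N by exact: leq_b1.
pose pos (k : X -> nat) := k @^-1` [set m | (0 < m)%N].
have posE k : (forall x, k x <= chi A x)%N -> forall x, (k x <= chi (pos k) x)%N.
  move=> kle x; have [kx|kx] := pselect (pos k x).
    by rewrite chi1//; exact: leq_trans (kle x) _.
  by rewrite chi0// leqNgt; apply/negP.
have k1A x : (k1 x <= chi A x)%N by have := kA x; lia.
have k2A x : (k2 x <= chi A x)%N by have := kA x; lia.
have s1 := equidec_subequiv Ak1 (posE _ k1A).
have s2 := equidec_subequiv Ak2 (posE _ k2A).
exists (pos k1), (pos k2); split => //.
- split.
    by case: (cont_nat_preimage [set m | (0 < m)%N] (equidec_cont actG Ak1).2).
  by case: (cont_nat_preimage [set m | (0 < m)%N] (equidec_cont actG Ak2).2).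
- by split; [exact: subequiv_nonempty s1|exact: subequiv_nonempty s2].
- by split=> x /= kx; apply/chi_gt0; [exact: leq_trans (k1A x)|exact: leq_trans (k2A x)].
- apply/seteqP; split => // x [k1x k2x].
  have k1x' : (0 < k1 x)%N by exact: k1x.
  have k2x' : (0 < k2 x)%N by exact: k2x.
  by have := kA x; have := chi_le1 x; lia.
Qed.

Lemma almost_unperforated_paradoxical :
  (forall mu : measure BorelX R,
    invariant_measure act mu -> ~ nontrivial_measure mu) ->
  almost_unperforated inv act -> paradoxical_comparison act.
Proof.
move=> nomu au O F oO [x0 Ox0] clF FO.
have [A [cA FA AO]] := clopen_between clF oO FO.
have [n x0O] := open_cylinder_sub oO Ox0.
(* The added cylinder keeps [B] nonempty even when [F] is empty. *)
pose B := A `|` cylinder n x0.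
have cB : clopen B by apply: clopenU => //; exact: clopen_cylinder.
have B0 : B !=set0 by exists x0; right.
have BO : B `<=` O by move=> x [/AO|/x0O].
have FB : F `<=` B by move=> x /FA; left.
have BB := almost_unperforated_double au cB (almost_properly_infinite cB nomu).
have [P [Q [oPQ PQ0 [PB QB] disPQ [BP BQ]]]] := double_paradoxical cB B0 BB.
exists P, Q; split => //.
  by split; [exact: subset_trans BO|exact: subset_trans BO].
by split; exact: subequivSl FB _.
Qed.

End Main.

Theorem theorem1p6 (R : realType) (G : countType)
    (mul : G -> G -> G) (inv : G -> G) (one : G) (act : G -> X -> X) :
  is_group mul inv one ->
  infinite_set [set: G] ->
  is_action mul one act ->
  (forall mu : measure BorelX R,
      invariant_measure act mu -> ~ nontrivial_measure mu) ->
  (almost_unperforated inv act <-> paradoxical_comparison act).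
Proof.
move=> groupG _ actG nomu; split.
  exact: (almost_unperforated_paradoxical groupG actG nomu).
exact: (paradoxical_almost_unperforated groupG actG).
Qed.
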